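(* Let $P$ be a causal program and $\langle P_b,P_t\rangle$ a partition of $P$ such that no atom occurring in the head of a rule of $P_t$ occurs in $P_b$. An interpretation $I$ is a causal stable model of $P$ if and only if there is a causal stable model $J$ of $P_b$ such that $I$ is a causal stable model of the program $J\cup P_t$, where an interpretation $J$ is identified with the program $\{1: A\leftarrow J(A)\mid A\in At\}$ (a rule with label $1$ whose body is the term $J(A)$).
   Context: Fix a set of labels $Lb$ and a set of atoms $At$. Terms are built by $t::=l\mid\prod S\mid\sum S\mid t_1\cdot t_2$ with $l\in Lb$ and $S$ any (possibly empty or infinite) set of terms; $1:=\prod\emptyset$, $0:=\sum\emptyset$; finite sums/products written with $+$, $*$. Causal values are equivalence classes of terms modulo the axioms of a completely distributive complete lattice with meet $*$ and join $+$ together with: $t\cdot(u\cdot w)=(t\cdot u)\cdot w$; $t=t+u\cdot t\cdot w$ and $u\cdot t\cdot w=t*u\cdot t\cdot w$; $1\cdot t=t=t\cdot1$; $t\cdot0=0=0\cdot t$; $l\cdot l=l$ for labels $l$; $\cdot$ distributes over (possibly infinite) sums on both sides; for terms $c,d,e$ without $+$: $c\cdot d\cdot e=(c\cdot d)*(d\cdot e)$ if $d\ne1$, $c\cdot(d*e)=(c\cdot d)*(c\cdot e)$, $(c*d)\cdot e=(c\cdot e)*(d\cdot e)$. $\mathbf V$ is the set of values, ordered by $t\le u$ iff $t*u=t$; $\mathbf C\subseteq\mathbf V$ is the set of values with a representative without $+$. $G\le_{\max}t$ means $G\in\mathbf C$, $G\le t$ and no $G'\in\mathbf C$ has $G<G'\le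 t$. A causal query is $\psi:\mathbf C\times\mathbf V\to\{0,1\}$ with $\psi(G,t)\le\psi(G,u)$ whenever $t\ge u$; monotonic if $\psi(G,u)\le\psi(G',w)$ whenever $G\le G'$ (any $u,w$). A causal literal is $(\psi::A)$, $A\in At$ (atom $A$ occurs in it). Literals: $(\psi::A)$ (positive), $\neg(\psi::A)$ (negative), $\neg\neg(\psi::A)$ (consistent). A causal program is a set of rules $r:H\leftarrow B_1,\dots,B_m$ with $r\in Lb$ or $r=1$, $H\in At$, each $B_i$ a literal or a term. An interpretation is $I:At\to\mathbf V$, ordered pointwise. $I(\psi::A)=\sum\{G\le_{\max}I(A):\psi(G,I(A))=1\}$; $I(t)=t$ for terms; $I(\neg L)=1$ iff $I(L)=0$ (else $0$); $I(\neg\neg L)=1$ iff $I(L)\ne0$ (else $0$); $I\models L$ iff $I(L)\ne0$. $I$ is a causal model of $P$ iff $(I(B_1)*\dots*I(B_m))\cdot r\le I(H)$ for every rule (empty product $=1$). Reduct: $\psi^t(G,u)=1$ iff there is $G'\in\mathbf C$ with $G'\le G$, $G'\le_{\max}t$, $\psi(G',t)=1$ (else $0$). The reduct of $(\psi::A)$ w.r.t. $I$ is $(\psi::A)$ if $\psi$ is monotonic and $(\psi^{I(A)}::A)$ otherwise. $P^I$: (i) delete every rule whose body has a negative or consistent literal not satisfied by $I$, (ii) delete the remaining negative and consistent literals, (iii) replace each remaining causal literal by its reduct. $P^I$ has a least causal model; $I$ is a causal stable model of $P$ iff $I$ is the least causal model of $P^I$. *)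

(* Defs.v *)
From Stdlib Require Import List Classical ClassicalEpsilon.
Import ListNotations.

Set Implicit Arguments.

Section Causal.

Variables (Lb At : Type).

(* Terms  t ::= l | prod S | sum S | t1 . t2.
   A (possibly empty or infinite) set S of terms is given as a family
   indexed by an arbitrary type I. *)
Inductive term : Type :=
| Lab : Lb -> term
| Prod : forall I : Type, (I -> term) -> term
| Sum : forall I : Type, (I -> term) -> term
| App : term -> term -> term.

Definition one : term := Prod (fun e : Empty_set => match e with end).
Definition zero : term := Sum (fun e : Empty_set => match e with end).
Definition meet (t u : term) : term := Prod (fun b : bool => if b then t else u).
Definition join (t u : term) : term := Sum (fun b : bool => if b then t else u).

Inductive nosum : term -> Prop :=
| ns_lab l : nosum (Lab l)
| ns_prod I (f : I -> term) : (forall i, nosum (f i)) -> nosum (Prod f)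
| ns_app t u : nosum t -> nosum u -> nosum (App t u).

(* some label occurs in the term; for +-free terms this is exactly "d <> 1" *)
Inductive haslab : term -> Prop :=
| hl_lab l : haslab (Lab l)
| hl_prod I (f : I -> term) i : haslab (f i) -> haslab (Prod f)
| hl_sum I (f : I -> term) i : haslab (f i) -> haslab (Sum f)
| hl_appl t u : haslab t -> haslab (App t u)
| hl_appr t u : haslab u -> haslab (App t u).

(* The least congruence generated by the axioms: completely distributive
   complete lattice (meet = Prod, join = Sum, order t <= u iff t*u = t)
   plus the axioms for the application operator. *)
Inductive ceq : term -> term -> Prop :=
| ce_refl t : ceq t t
| ce_sym t u : ceq t u -> ceq u t
| ce_trans t u v : ceq t u -> ceq u v -> ceq t v
| ce_cprod I (f g : I -> term) : (forall i, ceq (f i) (g i)) -> ceq (Prod f) (Prod g)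
| ce_csum I (f g : I -> term) : (forall i, ceq (f i) (g i)) -> ceq (Sum f) (Sum g)
| ce_capp t t' u u' : ceq t t' -> ceq u u' -> ceq (App t u) (App t' u')
| ce_le_refl t : ceq (meet t t) t
| ce_le_antisym t u : ceq (meet t u) t -> ceq (meet u t) u -> ceq t u
| ce_le_trans t u v : ceq (meet t u) t -> ceq (meet u v) u -> ceq (meet t v) t
| ce_prod_lb I (f : I -> term) i : ceq (meet (Prod f) (f i)) (Prod f)
| ce_prod_glb I (f : I -> term) t :
    (forall i, ceq (meet t (f i)) t) -> ceq (meet t (Prod f)) t
| ce_sum_ub I (f : I -> term) i : ceq (meet (f i) (Sum f)) (f i)
| ce_sum_lub I (f : I -> term) t :
    (forall i, ceq (meet (f i) t) (f i)) -> ceq (meet (Sum f) t) (Sum f)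
| ce_cdistr1 I (J : I -> Type) (F : forall i, J i -> term) :
    ceq (Prod (fun i => Sum (F i)))
        (Sum (fun phi : (forall i, J i) => Prod (fun i => F i (phi i))))
| ce_cdistr2 I (J : I -> Type) (F : forall i, J i -> term) :
    ceq (Sum (fun i => Prod (F i)))
        (Prod (fun phi : (forall i, J i) => Sum (fun i => F i (phi i))))
| ce_assoc t u w : ceq (App t (App u w)) (App (App t u) w)
| ce_absorb1 t u w : ceq t (join t (App (App u t) w))
| ce_absorb2 t u w : ceq (App (App u t) w) (meet t (App (App u t) w))
| ce_unitl t : ceq (App one t) t
| ce_unitr t : ceq (App t one) t
| ce_zeror t : ceq (App t zero) zero
| ce_zerol t : ceq (App zero t) zero
| ce_idem l : ceq (App (Lab l) (Lab l)) (Lab l)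
| ce_distl t I (f : I -> term) : ceq (App t (Sum f)) (Sum (fun i => App t (f i)))
| ce_distr t I (f : I -> term) : ceq (App (Sum f) t) (Sum (fun i => App (f i) t))
| ce_transit c d e : nosum c -> nosum d -> nosum e -> haslab d ->
    ceq (App (App c d) e) (meet (App c d) (App d e))
| ce_appmeetl c d e : nosum c -> nosum d -> nosum e ->
    ceq (App c (meet d e)) (meet (App c d) (App c e))
| ce_appmeetr c d e : nosum c -> nosum d -> nosum e ->
    ceq (App (meet c d) e) (meet (App c e) (App d e)).

Definition le (t u : term) : Prop := ceq (meet t u) t.
Definition lt (t u : term) : Prop := le t u /\ ~ ceq t u.

Definition inC (G : term) : Prop := exists g, nosum g /\ ceq G g.

Definition maxle (G t : term) : Prop :=
  inC G /\ le G t /\ forall G', inC G' -> lt G G' -> ~ le G' t.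

Definition is_join (S : term -> Prop) (t : term) : Prop :=
  (forall s, S s -> le s t) /\ (forall u, (forall s, S s -> le s u) -> le t u).
Definition sumset (S : term -> Prop) : term :=
  epsilon (inhabits zero) (is_join S).

(* causal queries: psi G t holds iff psi(G,t) = 1 *)
Definition query := term -> term -> Prop.

Definition is_query (psi : query) : Prop :=
  (* well defined on values *)
  (forall G G' t t', ceq G G' -> ceq t t' -> psi G t -> psi G' t') /\
  (forall G t u, inC G -> le u t -> psi G t -> psi G u).

Definition monotonic (psi : query) : Prop :=
  forall G G' u w, inC G -> inC G' -> le G G' -> psi G u -> psi G' w.

Definition qreduct (psi : query) (t : term) : query :=
  fun G _ => exists G', inC G' /\ le G' G /\ maxle G' t /\ psi G' t.

(* body elements: (psi::A), not (psi::A), not not (psi::A), or a term *)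
Inductive belt : Type :=
| Pos : query -> At -> belt
| Neg : query -> At -> belt
| Cons : query -> At -> belt
| Tm : term -> belt.

(* a rule r : H <- B1,...,Bm ; label None stands for r = 1 *)
Record rule : Type := mkRule { rlab : option Lb; rhead : At; rbody : list belt }.

Definition program := rule -> Prop.

Definition causal_program (P : program) : Prop :=
  forall r, P r -> forall b, In b (rbody r) ->
    match b with
    | Pos psi _ | Neg psi _ | Cons psi _ => is_query psi
    | Tm _ => True
    end.

Definition interp := At -> term.

Definition lit_val (I : interp) (psi : query) (A : At) : term :=
  sumset (fun G => maxle G (I A) /\ psi G (I A)).

Definition eval (I : interp) (b : belt) : term :=
  match b with
  | Pos psi A => lit_val I psi A
  | Neg psi A =>
      if excluded_middle_informative (ceq (lit_val I psi A) zero) then one else zero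
  | Cons psi A =>
      if excluded_middle_informative (ceq (lit_val I psi A) zero) then zero else one
  | Tm t => t
  end.

Definition sat (I : interp) (b : belt) : Prop := ~ ceq (eval I b) zero.

Definition labterm (o : option Lb) : term :=
  match o with Some l => Lab l | None => one end.

Definition body_val (I : interp) (bs : list belt) : term :=
  fold_right meet one (map (eval I) bs).

Definition is_model (I : interp) (P : program) : Prop :=
  forall r, P r -> le (App (body_val I (rbody r)) (labterm (rlab r))) (I (rhead r)).

Definition ile (I I' : interp) : Prop := forall A, le (I A) (I' A).

Definition least_model (I : interp) (P : program) : Prop :=
  is_model I P /\ forall I', is_model I' P -> ile I I'.

Definition lit_reduct (I : interp) (psi : query) (A : At) : query :=
  fun G u => (monotonic psi /\ psi G u) \/
             (~ monotonic psi /\ qreduct psi (I A) G u).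

Definition is_negcons (b : belt) : Prop :=
  match b with Neg _ _ | Cons _ _ => True | _ => False end.

Fixpoint body_reduct (I : interp) (bs : list belt) : list belt :=
  match bs with
  | [] => []
  | Pos psi A :: bs' => Pos (lit_reduct I psi A) A :: body_reduct I bs'
  | Neg _ _ :: bs' | Cons _ _ :: bs' => body_reduct I bs'
  | Tm t :: bs' => Tm t :: body_reduct I bs'
  end.

Definition reduct (I : interp) (P : program) : program :=
  fun r' => exists r, P r /\
    (forall b, In b (rbody r) -> is_negcons b -> sat I b) /\
    r' = mkRule (rlab r) (rhead r) (body_reduct I (rbody r)).

Definition stable_model (I : interp) (P : program) : Prop :=
  least_model I (reduct I P).

Definition interp_program (J : interp) : program :=
  fun r => exists A, r = mkRule None A [Tm (J A)].

Definition punion (P Q : program) : program := fun r => P r \/ Q r.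

Definition atom_in (A : At) (b : belt) : Prop :=
  match b with
  | Pos _ B | Neg _ B | Cons _ B => B = A
  | Tm _ => False
  end.

Definition occurs_in_rule (A : At) (r : rule) : Prop :=
  rhead r = A \/ exists b, In b (rbody r) /\ atom_in A b.

End Causal.

(* Main.v *)
Require Import Defs.
From Stdlib Require Import List Classical ClassicalEpsilon.

(** Off the heads of [Pt] a stable model [I] of [P] is a stable model of [Pb], and
    conversely; each half follows by comparing [I] with an interpretation that is
    [1] on the heads of [Pt], where the rules of [Pt] hold vacuously.

    The delicate point is that [I] is least among the models [I'] of [J] and the
    reduct of [Pt].  One would like the value of a reduced literal to be monotone in
    the interpretation, but it is not: a value such as the sum of an increasing
    sequence of +-free values may have no maximal +-free value below it.  Instead,
    [I'] is compared with [K], where [K A] is [I A] joined with all +-free values below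
    [I' A] that lie under no maximal one.  Every maximal +-free value below [K A] is
    then maximal below [I A] and lies under a maximal one below [I' A], so literals
    in [K] are bounded by those in [I] and in [I'].  This uses that every term is a sum of
    +-free terms and that +-free terms are join-prime; the latter is read off the
    interpretation of terms as lower sets of +-free terms. *)

Set Implicit Arguments.

Section Values.

Variable Lb : Type.
Notation term := (term Lb).
Implicit Types t u v g G : term.

(** * Order, lattice and application laws for values *)

Lemma le_refl t : le t t.
Proof. apply ce_le_refl. Qed.

Lemma le_trans t u v : le t u -> le u v -> le t v.
Proof. apply ce_le_trans. Qed.

Lemma le_antisym t u : le t u -> le u t -> ceq t u.
Proof. apply ce_le_antisym. Qed.

Lemma ceq_le t u : ceq t u -> le t u.
Proof.
  intros H. unfold le. eapply ce_trans; [|apply ce_le_refl].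
  apply ce_cprod. intros [|]; [apply ce_refl|apply ce_sym, H].
Qed.

Lemma ceq_ge t u : ceq t u -> le u t.
Proof. intros H; apply ceq_le, ce_sym, H. Qed.

Lemma prod_lb I (f : I -> term) i : le (Prod f) (f i).
Proof. apply ce_prod_lb. Qed.

Lemma prod_glb I (f : I -> term) t : (forall i, le t (f i)) -> le t (Prod f).
Proof. apply ce_prod_glb. Qed.

Lemma sum_ub I (f : I -> term) i : le (f i) (Sum f).
Proof. apply ce_sum_ub. Qed.

Lemma sum_lub I (f : I -> term) t : (forall i, le (f i) t) -> le (Sum f) t.
Proof. apply ce_sum_lub. Qed.

Lemma le_one t : le t (one Lb).
Proof. apply prod_glb. intros []. Qed.

Lemma zero_le t : le (zero Lb) t.
Proof. apply sum_lub. intros []. Qed.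

Lemma meet_lel t u : le (meet t u) t.
Proof. exact (prod_lb (fun b : bool => if b then t else u) true). Qed.

Lemma meet_ler t u : le (meet t u) u.
Proof. exact (prod_lb (fun b : bool => if b then t else u) false). Qed.

Lemma meet_mono t t' u u' : le t t' -> le u u' -> le (meet t u) (meet t' u').
Proof.
  intros Ht Hu. apply prod_glb. intros [|].
  - eapply le_trans; [apply meet_lel|exact Ht].
  - eapply le_trans; [apply meet_ler|exact Hu].
Qed.

Lemma join_gel t u : le t (join t u).
Proof. exact (sum_ub (fun b : bool => if b then t else u) true). Qed.

Lemma join_ger t u : le u (join t u).
Proof. exact (sum_ub (fun b : bool => if b then t else u) false). Qed.

Lemma join_absorb t u : le t u -> ceq (join t u) u.
Proof.
  intros H. apply le_antisym; [|apply join_ger].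
  apply sum_lub. intros [|]; [exact H|apply le_refl].
Qed.

(** If [t] is below [t'], then [t'] is the join of the two, and application distributes over that
    join. *)
Lemma app_monol t t' u : le t t' -> le (App t u) (App t' u).
Proof.
  intros H. apply le_trans with (App (join t t') u).
  - eapply le_trans; [|apply ceq_ge, ce_distr].
    exact (sum_ub (fun b : bool => App (if b then t else t') u) true).
  - apply ceq_le, ce_capp; [apply join_absorb, H|apply ce_refl].
Qed.

Lemma app_monor t u u' : le u u' -> le (App t u) (App t u').
Proof.
  intros H. apply le_trans with (App t (join u u')).
  - eapply le_trans; [|apply ceq_ge, ce_distl].
    exact (sum_ub (fun b : bool => App t (if b then u else u')) true).
  - apply ceq_le, ce_capp; [apply ce_refl|apply join_absorb, H].
Qed.

Lemma app_mono t t' u u' : le t t' -> le u u' -> le (App t u) (App t' u').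
Proof.
  intros Ht Hu. eapply le_trans; [apply app_monol, Ht|apply app_monor, Hu].
Qed.

Lemma app_app_le t u w : le (App (App u t) w) t.
Proof.
  eapply le_trans; [apply ceq_le, ce_absorb2|apply meet_lel].
Qed.

Lemma app_lel t u : le (App t u) t.
Proof.
  eapply le_trans; [|apply (app_app_le t (one Lb) u)].
  apply app_monol, ceq_ge, ce_unitl.
Qed.

Lemma app_ler t u : le (App t u) u.
Proof.
  eapply le_trans; [|apply (app_app_le u t (one Lb))].
  apply ceq_ge, ce_unitr.
Qed.

Lemma nosum_meet t u : nosum t -> nosum u -> nosum (meet t u).
Proof. intros Ht Hu. apply ns_prod. intros [|]; assumption. Qed.

Lemma nosum_one : nosum (one Lb).
Proof. apply ns_prod. intros []. Qed.

(** * Join-primeness of +-free terms *)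

(** The model of lower sets of +-free terms: intersections, unions, and the lower closure of
    pairwise applications. In the product case [nosum g] keeps the empty product from containing
    terms with sums. *)
Fixpoint den (t : term) : term -> Prop :=
  match t with
  | Lab l => fun g => nosum g /\ le g (Lab l)
  | Prod f => fun g => nosum g /\ forall i, den (f i) g
  | Sum f => fun g => exists i, den (f i) g
  | App t u => fun g => nosum g /\ exists a b, den t a /\ den u b /\ le g (App a b)
  end.

Lemma den_nosum {t g} : den t g -> nosum g.
Proof.
  revert g. induction t; simpl; intros g; [tauto|tauto| |tauto].
  intros [i Hi]. eauto.
Qed.

Lemma den_down {t g g'} : nosum g' -> le g' g -> den t g -> den t g'.
Proof.
  intros Hn Hl. induction t; simpl.
  - intros [_ H']. split; [exact Hn|exact (le_trans Hl H')].
  - intros [_ H']. split; auto.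
  - intros [i Hi]. eauto.
  - intros [_ (a & b & Ha & Hb & Hab)]. split; [exact Hn|].
    exists a, b. repeat split; auto. exact (le_trans Hl Hab).
Qed.

Lemma den_le {t g} : den t g -> le g t.
Proof.
  revert g. induction t; simpl; intros g.
  - tauto.
  - intros [_ H']. apply prod_glb. auto.
  - intros [i Hi]. eapply le_trans; [apply H, Hi|apply sum_ub].
  - intros [_ (a & b & Ha & Hb & Hab)]. eapply le_trans; [exact Hab|].
    apply app_mono; auto.
Qed.

Lemma den_self g : nosum g -> den g g.
Proof.
  induction 1; simpl.
  - split; [constructor|apply le_refl].
  - split; [constructor; auto|]. intros i.
    apply (den_down (g := f i)); [constructor; auto|apply prod_lb|auto].
  - split; [constructor; auto|]. exists t, u. repeat split; auto using le_refl.
Qed.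

Lemma den_principal {t} g : nosum t -> (den t g <-> nosum g /\ le g t).
Proof.
  intros Ht. split.
  - intros H. split; [exact (den_nosum H)|exact (den_le H)].
  - intros [Hg Hl]. exact (den_down Hg Hl (den_self Ht)).
Qed.

(** Both sides are principal lower sets, which depend only on the value of their generator. This
    settles label idempotence and the three axioms restricted to +-free terms. *)
Lemma den_nosum_ceq t u g : nosum t -> nosum u -> ceq t u -> (den t g <-> den u g).
Proof.
  intros Ht Hu H. rewrite (den_principal g Ht), (den_principal g Hu).
  split; intros [Hg Hl]; split; auto; eapply le_trans; eauto using ceq_le, ceq_ge.
Qed.

Lemma den_meet t u g : den (meet t u) g <-> den t g /\ den u g.
Proof.
  simpl. split.
  - intros [_ H]. split; [exact (H true)|exact (H false)].
  - intros [Ht Hu]. split; [exact (den_nosum Ht)|]. intros [|]; assumption.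
Qed.

Lemma den_join t u g : den (join t u) g <-> den t g \/ den u g.
Proof.
  simpl. split.
  - intros [[|] H]; auto.
  - intros [H|H]; [exists true|exists false]; exact H.
Qed.

Lemma den_one g : den (one Lb) g <-> nosum g.
Proof. simpl. split; [tauto|]. intros H. split; [exact H|intros []]. Qed.

Lemma den_zero {g} : ~ den (zero Lb) g.
Proof. simpl. intros [[] _]. Qed.

(** The inner application contributes some [x] below [App a b]; as [App a b] is itself a member and
    application is monotone, it can replace [x]. *)
Lemma den_app_app t u w g :
  den (App (App t u) w) g <->
  nosum g /\ exists a b c, den t a /\ den u b /\ den w c /\ le g (App (App a b) c).
Proof.
  simpl. split.
  - intros [Hg (x & c & [_ (a & b & Ha & Hb & Hx)] & Hc & Hl)].
    split; [exact Hg|]. exists a, b, c. repeat split; auto.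
    eapply le_trans; [exact Hl|apply app_monol, Hx].
  - intros [Hg (a & b & c & Ha & Hb & Hc & Hl)]. split; [exact Hg|].
    exists (App a b), c. repeat split; auto; [|exists a, b; auto using le_refl].
    constructor; eapply den_nosum; eassumption.
Qed.

Lemma den_app_app' t u w g :
  den (App t (App u w)) g <->
  nosum g /\ exists a b c, den t a /\ den u b /\ den w c /\ le g (App a (App b c)).
Proof.
  simpl. split.
  - intros [Hg (a & x & Ha & [_ (b & c & Hb & Hc & Hx)] & Hl)].
    split; [exact Hg|]. exists a, b, c. repeat split; auto.
    eapply le_trans; [exact Hl|apply app_monor, Hx].
  - intros [Hg (a & b & c & Ha & Hb & Hc & Hl)]. split; [exact Hg|].
    exists a, (App b c). repeat split; auto; [|exists b, c; auto using le_refl].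
    constructor; eapply den_nosum; eassumption.
Qed.

Lemma dependent_choice_fun (I : Type) (J : I -> Type) (R : forall i, J i -> Prop) :
  (forall i, exists j, R i j) -> exists phi : forall i, J i, forall i, R i (phi i).
Proof.
  intros H.
  exists (fun i => proj1_sig (constructive_indefinite_description _ (H i))).
  intros i. apply proj2_sig.
Qed.

(** Soundness of the lower-set model, by induction on the derivation: every axiom is checked
    there. *)
Lemma ceq_den t u : ceq t u -> forall g, den t g <-> den u g.
Proof.
  induction 1 as
    [ t | t u H IH | t u v H1 IH1 H2 IH2 | I f f' H IH | I f f' H IH
    | t t' u u' H1 IH1 H2 IH2 | t | t u H1 IH1 H2 IH2 | t u v H1 IH1 H2 IH2
    | I f i | I f t H IH | I f i | I f t H IH | I J F | I J F | t u w | t u w | t u w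
    | t | t | t | t | l | t I f | t I f
    | c d e Hc Hd He Hl | c d e Hc Hd He | c d e Hc Hd He ]; intros g.
  - tauto.
  - rewrite IH; tauto.
  - rewrite IH1; auto.
  - simpl. split; intros [Hg Hf]; split; auto; intros i; apply IH, Hf.
  - simpl. split; intros [i Hf]; exists i; apply IH, Hf.
  - simpl. split; intros [Hg (a & b & Ha & Hb & Hab)]; split; auto;
      exists a, b; rewrite IH1, IH2 in *; auto.
  - rewrite den_meet; tauto.
  - specialize (IH1 g); specialize (IH2 g). rewrite den_meet in *. tauto.
  - specialize (IH1 g); specialize (IH2 g). rewrite den_meet in *. tauto.
  - rewrite den_meet. simpl. split; [tauto|]. intros [Hg H]. auto.
  - rewrite den_meet. simpl. split; [tauto|]. intros Ht.
    split; [exact Ht|]. split; [exact (den_nosum Ht)|]. intros i.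
    specialize (IH i g). rewrite den_meet in IH. tauto.
  - rewrite den_meet. simpl. split; [tauto|]. eauto.
  - rewrite den_meet. simpl. split; [tauto|]. intros [i Hi].
    split; [eauto|]. specialize (IH i g). rewrite den_meet in IH. tauto.
  - simpl. split.
    + intros [Hg H]. destruct (dependent_choice_fun _ _ H) as [phi Hphi]. eauto.
    + intros [phi [Hg H]]. split; eauto.
  - simpl. split.
    + intros [i [Hg H]]. split; eauto.
    (* If [g] lies in none of the products, each product has a factor missing [g]; choosing these
       factors gives a [phi] whose sum misses [g]. *)
    + intros [Hg H]. apply NNPP. intros Hn.
      assert (HJ : forall i, exists j, ~ den (F i j) g).
      { intros i. apply not_all_ex_not. intros Hi. apply Hn. exists i. auto. }
      destruct (dependent_choice_fun _ _ HJ) as [phi Hphi].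
      destruct (H phi) as [i Hi]. exact (Hphi i Hi).
  - rewrite den_app_app, den_app_app'. split; intros [Hg (a & b & c & Ha & Hb & Hc & Hl)];
      split; auto; exists a, b, c; repeat split; auto;
      (eapply le_trans; [exact Hl|]); [apply ceq_le|apply ceq_ge]; apply ce_assoc.
  - rewrite den_join, den_app_app. split; [auto|].
    intros [Ht|[Hg (a & b & c & Ha & Hb & Hc & Hl)]]; [exact Ht|].
    refine (den_down Hg _ Hb). exact (le_trans Hl (app_app_le _ _ _)).
  - rewrite den_meet, den_app_app. split; [|tauto].
    intros [Hg (a & b & c & Ha & Hb & Hc & Hl)]. split; [|eauto 10].
    refine (den_down Hg _ Hb). exact (le_trans Hl (app_app_le _ _ _)).
  - split.
    + intros [Hg (a & b & _ & Hb & Hl)].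
      exact (den_down Hg (le_trans Hl (app_ler _ _)) Hb).
    + intros Ht. assert (Hg := den_nosum Ht). split; [exact Hg|].
      exists (one Lb), g. rewrite den_one. repeat split; auto using nosum_one.
      apply ceq_ge, ce_unitl.
  - split.
    + intros [Hg (a & b & Ha & _ & Hl)].
      exact (den_down Hg (le_trans Hl (app_lel _ _)) Ha).
    + intros Ht. assert (Hg := den_nosum Ht). split; [exact Hg|].
      exists g, (one Lb). rewrite den_one. repeat split; auto using nosum_one.
      apply ceq_ge, ce_unitr.
  - split; [|intros H; destruct (den_zero H)].
    intros [_ (a & b & _ & H & _)]. destruct (den_zero H).
  - split; [|intros H; destruct (den_zero H)].
    intros [_ (a & b & H & _ & _)]. destruct (den_zero H).
  - apply den_nosum_ceq; [repeat constructor|constructor|apply ce_idem].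
  - simpl. split.
    + intros [Hg (a & b & Ha & [i Hb] & Hl)]. exists i. split; eauto.
    + intros [i [Hg (a & b & Ha & Hb & Hl)]]. split; eauto 10.
  - simpl. split.
    + intros [Hg (a & b & [i Ha] & Hb & Hl)]. exists i. split; eauto.
    + intros [i [Hg (a & b & Ha & Hb & Hl)]]. split; eauto 10.
  - apply den_nosum_ceq; [repeat constructor; auto|apply nosum_meet; constructor; auto|].
    apply ce_transit; auto.
  - apply den_nosum_ceq; [constructor; auto using nosum_meet|
      apply nosum_meet; constructor; auto|].
    apply ce_appmeetl; auto.
  - apply den_nosum_ceq; [constructor; auto using nosum_meet|
      apply nosum_meet; constructor; auto|].
    apply ce_appmeetr; auto.
Qed.

(** [g] is in its own denotation, and [le g t] is an equation between [meet g t] and [g], so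
    soundness moves [g] into the denotation of [t]. *)
Lemma den_of_le t g : nosum g -> le g t -> den t g.
Proof.
  intros Hg Hl. apply den_self in Hg. apply (ceq_den Hl) in Hg.
  rewrite den_meet in Hg. tauto.
Qed.

(** The denotation of a sum is a union, so membership singles out one summand, even in an infinite
    sum. *)
Lemma inC_sum_prime I (f : I -> term) G :
  inC G -> le G (Sum f) -> exists i, le G (f i).
Proof.
  intros [g [Hg HG]] Hl.
  destruct (den_of_le (t := Sum f) Hg) as [i Hi].
  { exact (le_trans (ceq_ge HG) Hl). }
  exists i. exact (le_trans (ceq_le HG) (den_le Hi)).
Qed.

Lemma inC_join_prime t u G : inC G -> le G (join t u) -> le G t \/ le G u.
Proof.
  intros HG Hl. destruct (inC_sum_prime HG Hl) as [[|] H]; auto.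
Qed.

(** * Terms as sums of +-free terms *)

(** Indexes the disjuncts of the fully distributed form of [t]; a product takes one choice of
    disjunct per factor. Unlike [term], this type is small enough to index a [Sum]. *)
Fixpoint nfidx (t : term) : Type :=
  match t with
  | Lab _ => unit
  | @Prod _ X f => forall i : X, nfidx (f i)
  | @Sum _ X f => {i : X & nfidx (f i)}
  | App t u => (nfidx t * nfidx u)%type
  end.

Fixpoint nf (t : term) : nfidx t -> term :=
  match t return nfidx t -> term with
  | Lab l => fun _ => Lab l
  | Prod f => fun x => Prod (fun i => nf (f i) (x i))
  | Sum f => fun x => nf (f (projT1 x)) (projT2 x)
  | App t u => fun x => App (nf t (fst x)) (nf u (snd x))
  end.

Lemma nf_nosum t (x : nfidx t) : nosum (nf t x).
Proof. induction t; simpl; try constructor; auto. Qed.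

Lemma nf_inC t (x : nfidx t) : inC (nf t x).
Proof. exists (nf t x). split; [apply nf_nosum|apply ce_refl]. Qed.

Lemma nf_ceq t : ceq t (Sum (nf t)).
Proof.
  induction t as [l|I f IH|I f IH|t IHt u IHu]; simpl.
  - apply le_antisym; [exact (sum_ub (fun _ : unit => Lab l) tt)|].
    apply sum_lub. intros _. apply le_refl.
  - eapply ce_trans; [apply ce_cprod, IH|].
    exact (ce_cdistr1 (fun i => nfidx (f i)) (fun i => nf (f i))).
  - apply le_antisym.
    + apply sum_lub. intros i. eapply le_trans; [apply ceq_le, IH|].
      apply sum_lub. intros x.
      exact (sum_ub (fun y : {i : I & nfidx (f i)} => nf (f (projT1 y)) (projT2 y))
               (existT _ i x)).
    + apply sum_lub. intros [i x]; simpl. eapply le_trans; [|apply (sum_ub f i)].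
      eapply le_trans; [|apply ceq_ge, IH]. apply sum_ub.
  - apply le_antisym.
    + eapply le_trans; [apply ceq_le, ce_capp; [exact IHt|exact IHu]|].
      eapply le_trans; [apply ceq_le, ce_distl|]. apply sum_lub. intros y.
      eapply le_trans; [apply ceq_le, ce_distr|]. apply sum_lub. intros x.
      exact (sum_ub (fun z : nfidx t * nfidx u => App (nf t (fst z)) (nf u (snd z))) (x, y)).
    + apply sum_lub. intros [x y]; simpl. apply app_mono.
      * eapply le_trans; [|apply ceq_ge, IHt]. apply sum_ub.
      * eapply le_trans; [|apply ceq_ge, IHu]. apply sum_ub.
Qed.

Lemma nf_le t (x : nfidx t) : le (nf t x) t.
Proof. eapply le_trans; [|apply ceq_ge, nf_ceq]. apply sum_ub. Qed.

Lemma le_nf t G : inC G -> le G t -> exists x, le G (nf t x).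
Proof.
  intros HG Hl. apply inC_sum_prime; [exact HG|].
  exact (le_trans Hl (ceq_le (nf_ceq t))).
Qed.

(** * Maximal +-free values and literals *)

Lemma inC_ceq G G' : ceq G G' -> inC G -> inC G'.
Proof.
  intros H [g [Hg HG]]. exists g. split; [exact Hg|].
  eapply ce_trans; [apply ce_sym, H|exact HG].
Qed.

Lemma maxle_ceq G G' t t' : ceq G G' -> ceq t t' -> maxle G t -> maxle G' t'.
Proof.
  intros HG Ht (HC & Hl & Hmax). split; [exact (inC_ceq HG HC)|split].
  - exact (le_trans (ceq_ge HG) (le_trans Hl (ceq_le Ht))).
  - intros G'' HC'' [Hlt Hne] Hle. apply (Hmax G'' HC'').
    + split; [exact (le_trans (ceq_le HG) Hlt)|]. intros He. apply Hne.
      eapply ce_trans; [apply ce_sym, HG|exact He].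
    + exact (le_trans Hle (ceq_ge Ht)).
Qed.

Lemma maxle_eq G G' t : maxle G t -> inC G' -> le G G' -> le G' t -> ceq G G'.
Proof.
  intros (_ & _ & Hmax) HC Hl Ht. apply NNPP. intros Hne.
  exact (Hmax G' HC (conj Hl Hne) Ht).
Qed.

Lemma maxle_anti G t u : le t u -> le G t -> maxle G u -> maxle G t.
Proof.
  intros Htu HGt (HC & _ & Hmax). split; [exact HC|split; [exact HGt|]].
  intros G' HC' Hlt Hle. exact (Hmax G' HC' Hlt (le_trans Hle Htu)).
Qed.

Lemma is_join_unique (S S' : term -> Prop) t t' :
  (forall s, S s <-> S' s) -> is_join S t -> is_join S' t' -> ceq t t'.
Proof.
  intros HS [Hub Hlub] [Hub' Hlub']. apply le_antisym.
  - apply Hlub. intros s Hs. apply Hub', HS, Hs.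
  - apply Hlub'. intros s Hs. apply Hub, HS, Hs.
Qed.

Definition ceq_invariant (q : query Lb) : Prop :=
  forall G G' t t', ceq G G' -> ceq t t' -> q G t -> q G' t'.

(** [sumset] is chosen by [epsilon], so some join has to be exhibited. The maximal disjuncts of [t]
    satisfying [q] suffice, since a maximal [G] equals any disjunct above it. *)
Lemma sumset_maxle (q : query Lb) t :
  ceq_invariant q ->
  is_join (fun G => maxle G t /\ q G t) (sumset (fun G => maxle G t /\ q G t)).
Proof.
  intros Hq. unfold sumset. apply epsilon_spec.
  exists (Sum (fun x : {x : nfidx t | maxle (nf t x) t /\ q (nf t x) t} =>
                 nf t (proj1_sig x))).
  split.
  - intros G [HG HqG].
    destruct (le_nf (t := t) (proj1 HG)) as [x Hx]; [apply HG|].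
    assert (He : ceq G (nf t x)) by (apply (maxle_eq HG); auto using nf_inC, nf_le).
    assert (Hm : maxle (nf t x) t /\ q (nf t x) t).
    { split; [exact (maxle_ceq He (ce_refl t) HG)|exact (Hq _ _ _ _ He (ce_refl t) HqG)]. }
    eapply le_trans; [exact Hx|].
    exact (sum_ub (fun x : {x : nfidx t | maxle (nf t x) t /\ q (nf t x) t} =>
                 nf t (proj1_sig x)) (exist _ x Hm)).
  - intros u Hu. apply sum_lub. intros [x Hx]; simpl. auto.
Qed.

(** Ranging over disjuncts is enough: if [G] lies under no maximal value, neither does a disjunct
    above [G]. *)
Definition nonmax_part (t : term) : term :=
  Sum (fun x : {x : nfidx t | ~ exists M, maxle M t /\ le (nf t x) M} =>
         nf t (proj1_sig x)).

Lemma nonmax_part_spec t G :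
  inC G -> le G t -> (forall M, maxle M t -> ~ le G M) -> le G (nonmax_part t).
Proof.
  intros HC Hl Hn. destruct (le_nf HC Hl) as [x Hx].
  assert (H : ~ exists M, maxle M t /\ le (nf t x) M).
  { intros (M & HM & HxM). exact (Hn M HM (le_trans Hx HxM)). }
  eapply le_trans; [exact Hx|].
  exact (sum_ub (fun x : {x : nfidx t | ~ exists M, maxle M t /\ le (nf t x) M} =>
         nf t (proj1_sig x)) (exist _ x H)).
Qed.

(** By primeness a maximal [G] lies under one disjunct of this part. Anything in [t] above that
    disjunct again lies under no maximal value, hence is in the part and equals [G]; so the disjunct
    would itself be maximal below [t]. *)
Lemma nonmax_part_not_maxle t G : ~ maxle G (nonmax_part t).
Proof.
  intros HG. destruct (inC_sum_prime (proj1 HG) (proj1 (proj2 HG))) as [[x Hx] Hl].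
  simpl in Hl. apply Hx. exists (nf t x). split; [|apply le_refl].
  split; [apply nf_inC|split; [apply nf_le|]].
  intros G' HC' [Hlt Hne] Hle. apply Hne. apply le_antisym; [exact Hlt|].
  assert (He : ceq G G').
  { apply (maxle_eq HG); [exact HC'|exact (le_trans Hl Hlt)|].
    apply nonmax_part_spec; auto. intros M HM HM'. apply Hx. exists M.
    split; [exact HM|exact (le_trans Hlt HM')]. }
  exact (le_trans (ceq_ge He) Hl).
Qed.

(** Being prime, [G] lies under [a] or under the second joinand, and there it would be maximal,
    which is impossible. Not being under [nonmax_part t], it must lie under a maximal value of
    [t]. *)
Lemma maxle_join_nonmax a t G :
  le a t -> maxle G (join a (nonmax_part t)) ->
  maxle G a /\ exists M, maxle M t /\ le G M.
Proof.
  intros Hat HG. assert (HC := proj1 HG).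
  assert (Hn : ~ le G (nonmax_part t)).
  { intros Hl. apply (@nonmax_part_not_maxle t G).
    exact (maxle_anti (join_ger _ _) Hl HG). }
  destruct (inC_join_prime HC (proj1 (proj2 HG))) as [Hl|Hl]; [|tauto].
  split; [exact (maxle_anti (join_gel _ _) Hl HG)|].
  apply NNPP. intros Hne. apply Hn, nonmax_part_spec; eauto using le_trans.
Qed.

End Values.

Section Programs.

Variables Lb At : Type.
Notation interp := (interp Lb At).
Notation program := (program Lb At).
Implicit Types (I J K : interp) (P : program) (psi : query Lb).

(** * Reduced queries and literal values *)

Lemma lit_reduct_invariant I psi A :
  is_query psi -> ceq_invariant (lit_reduct I psi A).
Proof.
  intros [Hpsi _] G G' t t' HG Ht [[Hm H]|[Hm (M & HC & Hl & HM)]].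
  - left. split; [exact Hm|]. exact (Hpsi _ _ _ _ HG Ht H).
  - right. split; [exact Hm|]. exists M. split; [exact HC|].
    split; [exact (le_trans Hl (ceq_le HG))|exact HM].
Qed.

(** Reduced queries are monotonic: when [psi] is not, the witness found below [G] is also below
    [G'], and the second argument is ignored. *)
Lemma lit_reduct_up I psi A G G' t u :
  inC G -> inC G' -> le G G' -> lit_reduct I psi A G t -> lit_reduct I psi A G' u.
Proof.
  intros HC HC' Hl [[Hm H]|[Hm (M & HM & HlM & HM')]].
  - left. split; [exact Hm|]. exact (Hm _ _ _ _ HC HC' Hl H).
  - right. split; [exact Hm|]. exists M. split; [exact HM|].
    split; [exact (le_trans HlM Hl)|exact HM'].
Qed.

Lemma lit_reduct_ceq I J psi A G t :
  is_query psi -> ceq (I A) (J A) -> lit_reduct I psi A G t -> lit_reduct J psi A G t.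
Proof.
  intros [Hpsi _] HIJ [H|[Hm (M & HC & Hl & HM & HpM)]]; [left; exact H|].
  right. split; [exact Hm|]. exists M. split; [exact HC|]. split; [exact Hl|].
  split; [exact (maxle_ceq (ce_refl M) HIJ HM)|].
  exact (Hpsi _ _ _ _ (ce_refl M) HIJ HpM).
Qed.

Lemma lit_val_ceq I J (q q' : query Lb) A :
  ceq_invariant q -> ceq_invariant q' -> (forall G t, q G t <-> q' G t) ->
  ceq (I A) (J A) -> ceq (lit_val I q A) (lit_val J q' A).
Proof.
  intros Hq Hq' Hqq' HIJ. unfold lit_val.
  refine (is_join_unique _ (sumset_maxle _ Hq) (sumset_maxle _ Hq')).
  intros G. split; intros [HM HG].
  - split; [exact (maxle_ceq (ce_refl G) HIJ HM)|].
    apply Hqq'. exact (Hq _ _ _ _ (ce_refl G) HIJ HG).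
  - split; [exact (maxle_ceq (ce_refl G) (ce_sym HIJ) HM)|].
    apply Hqq'. exact (Hq' _ _ _ _ (ce_refl G) (ce_sym HIJ) HG).
Qed.

(** Replaces the failing monotonicity in the interpretation: each summand on the left lies under a
    maximal value of [J A], which also satisfies the reduced query. *)
Lemma lit_val_le_of_maxle I J K psi A :
  is_query psi ->
  (forall G, maxle G (K A) -> exists M, maxle M (J A) /\ le G M) ->
  le (lit_val K (lit_reduct I psi A) A) (lit_val J (lit_reduct I psi A) A).
Proof.
  intros Hpsi H. assert (Hq := @lit_reduct_invariant I psi A Hpsi).
  apply (sumset_maxle (K A) Hq). intros G [HG HqG].
  destruct (H G HG) as (M & HM & HGM).
  eapply le_trans; [exact HGM|]. apply (sumset_maxle (J A) Hq).
  split; [exact HM|].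
  exact (lit_reduct_up _ (proj1 HG) (proj1 HM) HGM HqG).
Qed.

(** * Rule bodies and models of reducts *)

Lemma body_reduct_le I I' K K' (bs : list (belt Lb At)) :
  (forall psi A, In (Pos psi A) bs ->
     le (lit_val K (lit_reduct I psi A) A) (lit_val K' (lit_reduct I' psi A) A)) ->
  le (body_val K (body_reduct I bs)) (body_val K' (body_reduct I' bs)).
Proof.
  induction bs as [|b bs IH]; intros H; [apply le_refl|].
  assert (IH' := IH (fun psi A Hin => H psi A (or_intror Hin))).
  destruct b as [psi A|psi A|psi A|t]; simpl; auto; apply meet_mono; auto using le_refl.
  apply H. left. reflexivity.
Qed.

Definition blocked (I : interp) (r : rule Lb At) : Prop :=
  exists b, In b (rbody r) /\ is_negcons b /\ ~ sat I b.

Definition rule_holds (I K : interp) (r : rule Lb At) : Prop :=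
  le (App (body_val K (body_reduct I (rbody r))) (labterm (rlab r))) (K (rhead r)).

Lemma is_model_reduct I K P :
  is_model K (reduct I P) <-> forall r, P r -> ~ blocked I r -> rule_holds I K r.
Proof.
  split.
  - intros H r Hr Hb.
    apply (H (mkRule (rlab r) (rhead r) (body_reduct I (rbody r)))).
    exists r. split; [exact Hr|split; [|reflexivity]].
    intros b Hin Hnc Hs. apply Hb. exists b. split; [exact Hin|split; [exact Hnc|]].
    intros Hs'. exact (Hs' Hs).
  - intros H r' (r & Hr & Hsat & ->). apply (H r Hr).
    intros (b & Hin & Hnc & Hs). exact (Hs (Hsat b Hin Hnc)).
Qed.

Lemma is_model_reduct_union I K P Q :
  is_model K (reduct I (punion P Q)) <->
  is_model K (reduct I P) /\ is_model K (reduct I Q).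
Proof.
  rewrite !is_model_reduct. unfold punion. split.
  - intros H. split; intros r Hr; apply H; auto.
  - intros [HP HQ] r [Hr|Hr]; auto.
Qed.

(** A body consisting of a term survives the reduct unchanged, and its units cancel. *)
Lemma is_model_reduct_interp I J K :
  is_model K (reduct I (interp_program J)) <-> ile J K.
Proof.
  assert (He : forall A, ceq (App (meet (J A) (one Lb)) (one Lb)) (J A)).
  { intros A. eapply ce_trans; [apply ce_unitr|]. apply le_antisym; [apply meet_lel|].
    apply prod_glb. intros [|]; [apply le_refl|apply le_one]. }
  rewrite is_model_reduct. split.
  - intros H A. eapply le_trans; [apply ceq_ge, He|].
    apply (H (mkRule None A (cons (Tm At (J A)) nil))); [exists A; reflexivity|].
    intros (b & [<-|[]] & [] & _).
  - intros H r [A ->] _. eapply le_trans; [apply ceq_le, He|apply H].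
Qed.

Lemma stable_model_ext {I P Q} :
  (forall r, P r <-> Q r) -> stable_model I P -> stable_model I Q.
Proof.
  intros HPQ [Hm Hl].
  assert (H : forall K, is_model K (reduct I P) <-> is_model K (reduct I Q)).
  { intros K. rewrite !is_model_reduct. split; intros H r Hr; apply H, HPQ, Hr. }
  split; [apply H, Hm|]. intros K HK. apply Hl, H, HK.
Qed.

Lemma causal_pos_query {P r psi A} :
  causal_program P -> P r -> In (Pos psi A) (rbody r) -> is_query psi.
Proof. intros HP Hr Hin. exact (HP r Hr _ Hin). Qed.

Lemma sat_ceq I J b :
  is_negcons b ->
  match b with Pos psi _ | Neg psi _ | Cons psi _ => is_query psi | Tm _ _ => True end ->
  (forall A, atom_in A b -> ceq (I A) (J A)) -> sat I b -> sat J b.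
Proof.
  destruct b as [psi A|psi A|psi A|t]; simpl; try tauto; intros _ [Hq _] Hat;
    unfold sat, eval;
    assert (He := lit_val_ceq _ _ _ Hq Hq (fun G t => iff_refl (psi G t)) (Hat A eq_refl));
    destruct (excluded_middle_informative (ceq (lit_val I psi A) (zero Lb))) as [H1|H1];
    destruct (excluded_middle_informative (ceq (lit_val J psi A) (zero Lb))) as [H2|H2];
    try tauto; exfalso;
    first [apply H2; eapply ce_trans; [apply ce_sym, He|exact H1]
          |apply H1; eapply ce_trans; [exact He|exact H2]].
Qed.

(** Deleted rules, reduced queries and body values depend only on atoms of [P]. This carries models
    of [Pb] between interpretations that agree off the heads of [Pt]. *)
Lemma is_model_reduct_ceq I I' K K' P :
  causal_program P ->
  (forall r A, P r -> occurs_in_rule A r -> ceq (I A) (I' A) /\ ceq (K A) (K' A)) ->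
  is_model K (reduct I P) -> is_model K' (reduct I' P).
Proof.
  intros HP Hoc. rewrite !is_model_reduct. intros HK r Hr Hb.
  assert (Hat : forall b A, In b (rbody r) -> atom_in A b ->
            ceq (I A) (I' A) /\ ceq (K A) (K' A)).
  { intros b A Hin HA. apply (Hoc r A Hr). right. exists b. auto. }
  assert (Hb' : ~ blocked I r).
  { intros (b & Hin & Hnc & Hs). apply Hb. exists b. split; [exact Hin|].
    split; [exact Hnc|]. intros Hs'. apply Hs. revert Hs'.
    apply sat_ceq; [exact Hnc|exact (HP r Hr b Hin)|].
    intros A HA. apply ce_sym, (Hat b A Hin HA). }
  eapply le_trans; [|eapply le_trans; [exact (HK r Hr Hb')|]].
  - apply app_monol, body_reduct_le. intros psi A Hin.
    assert (Hq := causal_pos_query HP Hr Hin).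
    destruct (Hat _ A Hin eq_refl) as [HI HKA].
    apply ceq_le, lit_val_ceq; auto using lit_reduct_invariant, ce_sym.
    intros G t. split; apply lit_reduct_ceq; auto using ce_sym.
  - apply ceq_le, (Hoc r _ Hr). left. reflexivity.
Qed.

Lemma is_model_reduct_heads_top I K P :
  (forall r, P r -> K (rhead r) = one Lb) -> is_model K (reduct I P).
Proof.
  intros H. apply is_model_reduct. intros r Hr _. unfold rule_holds.
  rewrite (H r Hr). apply le_one.
Qed.

Definition override (X : At -> Prop) (I J : interp) : interp :=
  fun A => if excluded_middle_informative (X A) then I A else J A.

Lemma override_in (X : At -> Prop) I J A : X A -> override X I J A = I A.
Proof.
  unfold override. destruct (excluded_middle_informative (X A)); tauto.
Qed.

Lemma override_out (X : At -> Prop) I J A : ~ X A -> override X I J A = J A.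
Proof.
  unfold override. destruct (excluded_middle_informative (X A)); tauto.
Qed.

(** * The two directions of the splitting *)

Section Splitting.

Variables Pb Pt : program.
Hypothesis Pb_causal : causal_program Pb.
Hypothesis Pt_causal : causal_program Pt.
Hypothesis split : forall r r', Pt r -> Pb r' -> ~ occurs_in_rule (rhead r) r'.

Definition top_head (A : At) : Prop := exists r, Pt r /\ rhead r = A.

Lemma top_head_rhead r : Pt r -> top_head (rhead r).
Proof. intros Hr. exists r. auto. Qed.

Lemma bottom_not_top_head r A : Pb r -> occurs_in_rule A r -> ~ top_head A.
Proof. intros Hr Ho (r' & Hr' & <-). exact (split Hr' Hr Ho). Qed.

Lemma bottom_stable I :
  stable_model I (punion Pb Pt) ->
  stable_model (override top_head (fun _ => zero Lb) I) Pb.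
Proof.
  (* [J] is [0] on the heads of [Pt]: no rule of [Pb] has such a head, so a least model must vanish
     there. *)
  intros [Hm Hl]. set (J := override _ _ _).
  assert (HIJ : forall r A, Pb r -> occurs_in_rule A r -> ceq (I A) (J A)).
  { intros r A Hr Ho. unfold J. rewrite override_out; [apply ce_refl|].
    exact (bottom_not_top_head Hr Ho). }
  apply is_model_reduct_union in Hm. split.
  - apply (is_model_reduct_ceq (I := I) (K := I)); eauto. apply Hm.
  - intros J' HJ'.
    assert (H : ile I (override top_head (fun _ => one Lb) J')).
    { apply Hl, is_model_reduct_union. split.
      - apply (is_model_reduct_ceq (I := J) (K := J')); auto.
        intros r A Hr Ho. split; [exact (ce_sym (HIJ r A Hr Ho))|].
        rewrite override_out; [apply ce_refl|exact (bottom_not_top_head Hr Ho)].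
      - apply is_model_reduct_heads_top. intros r Hr.
        apply override_in, top_head_rhead, Hr. }
    intros A. specialize (H A). unfold J, override in *.
    destruct (excluded_middle_informative (top_head A)); [apply zero_le|exact H].
Qed.

Lemma stable_relative_bottom I :
  stable_model I (punion Pb Pt) ->
  stable_model I
    (punion (interp_program (override top_head (fun _ => zero Lb) I)) Pt).
Proof.
  intros [Hm Hl]. set (J := override _ _ _).
  apply is_model_reduct_union in Hm. destruct Hm as [Hmb Hmt]. split.
  - apply is_model_reduct_union. split; [|exact Hmt].
    apply is_model_reduct_interp. intros A. unfold J, override.
    destruct (excluded_middle_informative (top_head A)); [apply zero_le|apply le_refl].
  - intros I' HI'. apply is_model_reduct_union in HI'. destruct HI' as [HJ Hmt'].
    apply is_model_reduct_interp in HJ.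
    assert (Hout : forall A, ~ top_head A -> le (I A) (I' A)).
    { intros A HA. specialize (HJ A). unfold J in HJ. rewrite override_out in HJ; auto. }
    (* [K] equals [I'] on the heads of [Pt], so leastness of [I] against [K] gives the bound exactly
       where [Hout] does not. *)
    pose (K := override top_head I' (fun A => join (I A) (nonmax_part (I' A)))).
    assert (H : ile I K).
    { apply Hl, is_model_reduct_union. split; apply is_model_reduct; intros r Hr Hb.
      (* For a rule of [Pb], the body in [K] is bounded by the body in [I], and the head in [I] by
         the head in [K]. *)
      - unfold rule_holds. eapply le_trans.
        + apply app_monol, body_reduct_le. intros psi A Hin.
          apply (lit_val_le_of_maxle I I K); [exact (causal_pos_query Pb_causal Hr Hin)|].
          assert (HA : ~ top_head A).
          { apply (bottom_not_top_head Hr). right. exists (Pos psi A). simpl. auto. }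
          intros G HG. unfold K in HG. rewrite override_out in HG by exact HA.
          exists G. split; [|apply le_refl].
          exact (proj1 (maxle_join_nonmax (Hout A HA) HG)).
        + eapply le_trans; [exact (proj1 (is_model_reduct _ _ _) Hmb r Hr Hb)|].
          unfold K. rewrite override_out; [apply join_gel|].
          apply (bottom_not_top_head Hr). left. reflexivity.
      (* For a rule of [Pt], the body in [K] is bounded by the body in [I'], and both give the head
         the same value. *)
      - unfold rule_holds. eapply le_trans.
        + apply app_monol, body_reduct_le. intros psi A Hin.
          apply (lit_val_le_of_maxle I I' K); [exact (causal_pos_query Pt_causal Hr Hin)|].
          intros G HG. unfold K, override in HG.
          destruct (excluded_middle_informative (top_head A)) as [HA|HA].
          * exists G. split; [exact HG|apply le_refl].
          * exact (proj2 (maxle_join_nonmax (Hout A HA) HG)).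
        + eapply le_trans; [exact (proj1 (is_model_reduct _ _ _) Hmt' r Hr Hb)|].
          unfold K. rewrite override_in; [apply le_refl|apply top_head_rhead, Hr]. }
    intros A. destruct (classic (top_head A)) as [HA|HA]; [|auto].
    specialize (H A). unfold K in H. rewrite override_in in H; auto.
Qed.

Lemma stable_of_split I J :
  stable_model J Pb -> stable_model I (punion (interp_program J) Pt) ->
  stable_model I (punion Pb Pt).
Proof.
  intros [HJm HJl] [HIm HIl]. apply is_model_reduct_union in HIm.
  destruct HIm as [HJI HIt]. apply is_model_reduct_interp in HJI.
  (* Gives [I] below [J] off the heads of [Pt]; with [HJI] the two agree on all atoms of [Pb]. *)
  assert (Hle : ile I (override top_head (fun _ => one Lb) J)).
  { apply HIl, is_model_reduct_union. split.
    - apply is_model_reduct_interp. intros A. unfold override.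
      destruct (excluded_middle_informative (top_head A)); [apply le_one|apply le_refl].
    - apply is_model_reduct_heads_top. intros r Hr.
      apply override_in, top_head_rhead, Hr. }
  assert (HIJ : forall r A, Pb r -> occurs_in_rule A r -> ceq (J A) (I A)).
  { intros r A Hr Ho. apply le_antisym; [apply HJI|].
    specialize (Hle A). rewrite override_out in Hle; [exact Hle|].
    exact (bottom_not_top_head Hr Ho). }
  split.
  - apply is_model_reduct_union. split; [|exact HIt].
    apply (is_model_reduct_ceq (I := J) (K := J)); eauto.
  - intros I' HI'. apply is_model_reduct_union in HI'. destruct HI' as [Hb Ht].
    apply HIl, is_model_reduct_union. split; [|exact Ht].
    (* As [I] and [J] agree on the atoms of [Pb], its reducts by them have the same models; so [I']
       is a model for [J] too, and leastness of [J] puts [J] below [I']. *)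
    apply is_model_reduct_interp, HJl.
    apply (is_model_reduct_ceq (I := I) (K := I')); eauto using ce_refl, ce_sym.
Qed.

End Splitting.

End Programs.

Unset Implicit Arguments.

Theorem theorem3 (Lb At : Type) (P Pb Pt : program Lb At) :
  causal_program P ->
  (forall r, P r <-> Pb r \/ Pt r) ->
  (forall r, Pb r -> Pt r -> False) ->
  (forall r r', Pt r -> Pb r' -> ~ occurs_in_rule (rhead r) r') ->
  forall I : interp Lb At,
    stable_model I P <->
    exists J : interp Lb At,
      stable_model J Pb /\ stable_model I (punion (interp_program J) Pt).
Proof.
  intros HP Hpart _ Hsplit I.
  assert (Hb : causal_program Pb) by (intros r Hr; apply HP, Hpart; auto).
  assert (Ht : causal_program Pt) by (intros r Hr; apply HP, Hpart; auto).
  split.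
  - intros HI. apply (stable_model_ext (Q := punion Pb Pt)) in HI; [|exact Hpart].
    exists (override (top_head Pt) (fun _ => zero Lb) I).
    split; [apply bottom_stable|apply (stable_relative_bottom (Pb := Pb))]; auto.
  - intros (J & HJ & HI). apply (stable_model_ext (P := punion Pb Pt)).
    + intros r. symmetry. apply Hpart.
    + exact (stable_of_split Hb Hsplit HJ HI).
Qed.
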